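(* Let $(R,\mathcal{B}_1,\mathcal{G})$ and $(R,\mathcal{B}_2,\mathcal{G})$ be two disjoint $\mathrm{GDD}_\lambda(t,k,r)$ of type $v^g$, each with $b$ blocks, where $R=\{1,\ldots,r\}$ and $k<g$. Let $X_1$ and $X_2$ be the sets of characteristic vectors of the blocks in $\mathcal{B}_1$ and $\mathcal{B}_2$, respectively. Then $(X_1,X_2)$ is a proper $\mathrm{PTE}_r$ solution of degree $t$ and size $b$.
   Context: Let $\lambda,t,k,g,v,r$ be positive integers with $t\le k\le g\le r=gv$. A group divisible design $\mathrm{GDD}_\lambda(t,k,r)$ of type $v^g$ is a triple $(R,\mathcal{B},\mathcal{G})$ where $R$ is an $r$-element set, $\mathcal{B}$ is a set of $k$-element subsets of $R$ (blocks), and $\mathcal{G}=\{G_1,\ldots,G_g\}$ is a set of $v$-element subsets of $R$ (groups), such that (i) $R$ is the disjoint union of $G_1,\ldots,G_g$; (ii) $|B\cap G_i|\le1$ for all $B\in\mathcal{B}$ and all $i$; (iii) every $t$-element subset $T\subseteq R$ with $|T\cap G_i|\le1$ for all $i$ is contained in exactly $\lambda$ blocks. Two GDDs $(R,\mathcal{B}_1,\mathcal{G})$, $(R,\mathcal{B}_2,\mathcal{G})$ are disjoint if $\mathcal{B}_1\cap\mathcal{B}_2=\emptyset$. The characteristic vector of $B\subseteq\{1,\ldots,r\}$ is $(x_1,\ldots,x_r)$ with $x_i=1$ if $i\in B$ and $0$ otherwise. For multisets $A=\{\mathbf{a}_1,\ldots,\mathbf{a}_n\}$, $B=\{\mathbf{b}_1,\ldots,\mathbf{b}_n\}\subset\mathbb{Q}^r$,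 $(A,B)$ is a $\mathrm{PTE}_r$ solution of degree $m$ and size $n$ if $A,B$ have no common element and $\sum_i\prod_j a_{ij}^{k_j}=\sum_i\prod_j b_{ij}^{k_j}$ for all nonnegative integers $k_j$ with $1\le\sum_jk_j\le m$ (where $\mathbf{a}_i=(a_{i1},\ldots,a_{ir})$, etc.); it is proper if the $n\times r$ matrices with rows $\mathbf{a}_i$ resp. $\mathbf{b}_i$ both have rank $r$.
   Formalization: Properness (rank r) is claimed only for t ≥ 2, since it fails for t = 1 (groups {1,2},{3,4},{5,6}, blocks {13,25,46} and {14,26,35}: a 3×6 matrix cannot have rank 6); the PTE property of degree t and size b is proved for all t ≥ 1. *)

(* Defs.v *)
From HB Require Import structures.
From mathcomp Require Import all_boot all_order all_algebra.

Set Implicit Arguments.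
Unset Strict Implicit.
Unset Printing Implicit Defensive.

Import Order.TTheory GRing.Theory Num.Theory.
Local Open Scope ring_scope.

Definition at_most_one_per_group (R : finType) (GG : {set {set R}})
    (S : {set R}) : Prop :=
  forall Gi : {set R}, Gi \in GG -> (#|S :&: Gi| <= 1)%N.

Record is_GDD (R : finType) (lambda t k r v g : nat)
    (BB GG : {set {set R}}) : Prop := IsGDD {
  gdd_lambda_gt0 : (0 < lambda)%N;
  gdd_t_gt0 : (0 < t)%N;
  gdd_v_gt0 : (0 < v)%N;
  gdd_le_tk : (t <= k)%N;
  gdd_le_kg : (k <= g)%N;
  gdd_le_gr : (g <= r)%N;
  gdd_r_eq : r = (g * v)%N;
  gdd_card_points : #|R| = r;
  gdd_card_block : forall B : {set R}, B \in BB -> #|B| = k;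
  gdd_card_groups : #|GG| = g;
  gdd_card_group : forall Gi : {set R}, Gi \in GG -> #|Gi| = v;
  gdd_partition : partition GG [set: R];
  gdd_block_group : forall B : {set R}, B \in BB -> at_most_one_per_group GG B;
  gdd_balanced : forall T : {set R}, #|T| = t -> at_most_one_per_group GG T ->
    #|[set B in BB | T \subset B]| = lambda
}.

Definition disjoint_designs (R : finType) (BB1 BB2 : {set {set R}}) : Prop :=
  BB1 :&: BB2 = set0.

(* The point set {1, ..., r} is rendered as 'I_r = {0, ..., r - 1}. *)
Definition char_vec (r : nat) (B : {set 'I_r}) : 'rV[rat]_r :=
  \row_j (if j \in B then 1 else 0).

Lemma char_vec_inj (r : nat) : injective (@char_vec r).
Proof.
move=> A B /rowP eqAB; apply/setP => j.
by have := eqAB j; rewrite !mxE; do 2!case: (j \in _) => // /eqP;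
  rewrite ?oner_eq0 // eq_sym oner_eq0.
Qed.

(* A set of vectors, given by a duplicate-free enumeration (char_vecs_uniq). *)
Definition char_vecs (r : nat) (BB : {set {set 'I_r}}) : seq 'rV[rat]_r :=
  [seq char_vec B | B <- enum BB].

Lemma char_vecs_uniq (r : nat) (BB : {set {set 'I_r}}) : uniq (char_vecs BB).
Proof. by rewrite map_inj_uniq ?enum_uniq //; apply: char_vec_inj. Qed.

(* Finite multisets of Q^r are represented by sequences; nothing below depends
   on the order of the entries. *)
Record is_PTE (r m n : nat) (A B : seq 'rV[rat]_r) : Prop := IsPTE {
  pte_sizel : size A = n;
  pte_sizer : size B = n;
  pte_no_common : forall x : 'rV[rat]_r, ~ (x \in A /\ x \in B);
  pte_moments : forall e : 'I_r -> nat, (1 <= \sum_(j < r) e j <= m)%N ->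
    \sum_(a <- A) \prod_(j < r) a ord0 j ^+ e j
      = \sum_(b <- B) \prod_(j < r) b ord0 j ^+ e j
}.

Definition rows_mx (r n : nat) (A : seq 'rV[rat]_r) : 'M[rat]_(n, r) :=
  \matrix_(i < n) nth 0 A i.

(* Disjoint designs with t = 1 need not give a proper solution: for groups
   {1,2}, {3,4}, {5,6} and blocks {13, 25, 46}, {14, 26, 35}, the matrices are
   3 x 6. Hence properness is only claimed for t >= 2. *)
Definition is_proper_PTE (r m n : nat) (A B : seq 'rV[rat]_r) : Prop :=
  [/\ is_PTE m n A B, \rank (rows_mx n A) = r & \rank (rows_mx n B) = r].

(* Main.v *)
Require Import Defs.
From HB Require Import structures.
From mathcomp Require Import all_boot all_order all_algebra.

Set Implicit Arguments.
Unset Strict Implicit.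
Unset Printing Implicit Defensive.

Import Order.TTheory GRing.Theory Num.Theory.
Local Open Scope ring_scope.

(* A GDD of strength [s + 1] is also one of strength [s]: double counting gives
   [lambda_s (k - s) = lambda_(s + 1) (g - s) v].  The monomial with exponents
   [e] takes the value 1 at the characteristic vector of a block containing the
   support of [e] and 0 at the others, so moments of degree at most [t] count
   blocks through at most [t] points, and these counts agree in both designs.
   For the rank, the Gram matrix of the points has entries [lambda_1] on the
   diagonal, 0 inside a group and [lambda_2] elsewhere; it is nonsingular since
   [lambda_1 (k - 1) = lambda_2 (g - 1) v] and [k < g] give
   [lambda_1 > lambda_2 v]. *)

(** * Sets meeting each group at most once *)

Lemma at_most_one_per_groupP (R : finType) (GG : {set {set R}}) (S : {set R}) :
  partition GG [set: R] ->
  at_most_one_per_group GG S <-> {in S &, injective (pblock GG)}.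
Proof.
move=> partG; have /and3P[/eqP covG trivG _] := partG.
have inG x : x \in cover GG by rewrite covG inE.
split=> [oneS x y Sx Sy eqxy | injS Gi GGi].
  have /card_le1_eqP := oneS _ (pblock_mem (inG x)); apply.
    by rewrite inE Sy eqxy mem_pblock inG.
  by rewrite inE Sx mem_pblock inG.
apply/card_le1_eqP => x y /setIP[Sx Gx] /setIP[Sy Gy].
by apply: injS; rewrite // (def_pblock trivG GGi Gx) (def_pblock trivG GGi Gy).
Qed.

Lemma at_most_one_per_groupS (R : finType) (GG : {set {set R}})
    (S T : {set R}) :
  S \subset T -> at_most_one_per_group GG T -> at_most_one_per_group GG S.
Proof.
move=> sST oneT Gi GGi; apply: leq_trans (oneT _ GGi).
by rewrite subset_leq_card ?setSI.
Qed.

Lemma exists_transversal_of_card (R : finType) (GG : {set {set R}}) (s : nat) :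
  partition GG [set: R] -> (s <= #|GG|)%N ->
  exists2 S : {set R}, #|S| = s & at_most_one_per_group GG S.
Proof.
move=> partG; have trX := transversalP partG.
rewrite -(card_transversal trX) => le_s.
have : (0 < 'C(#|transversal GG [set: R]|, s))%N by rewrite bin_gt0.
rewrite -cards_draws => /card_gt0P[S]; rewrite inE => /andP[sSX /eqP cardS].
exists S => //; apply: at_most_one_per_groupS sSX _.
apply/(at_most_one_per_groupP _ partG) => x y.
exact: (pblock_inj trX).
Qed.

(** The missed points form the union of the groups outside the image of [S], and [S] meets exactly
    [#|S|] groups by injectivity. *)
Lemma card_groups_missed (R : finType) (GG : {set {set R}}) (v : nat)
    (S : {set R}) :
  partition GG [set: R] -> (forall Gi, Gi \in GG -> #|Gi| = v) ->
  at_most_one_per_group GG S ->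
  #|[set x | pblock GG x \notin pblock GG @: S]| = ((#|GG| - #|S|) * v)%N.
Proof.
move=> partG cardG /(at_most_one_per_groupP _ partG) injS.
have /and3P[/eqP covG trivG _] := partG.
have inG x : x \in cover GG by rewrite covG inE.
set P := pblock GG @: S.
have sPG : P \subset GG.
  by apply/subsetP => _ /imsetP[x _ ->]; exact: pblock_mem.
have -> : [set x | pblock GG x \notin P] = cover (GG :\: P).
  apply/setP => x; rewrite inE; apply/idP/bigcupP => [xP | [A]].
    exists (pblock GG x); last by rewrite mem_pblock inG.
    by rewrite inE xP pblock_mem.
  by rewrite inE => /andP[AP GA] Ax; rewrite (def_pblock trivG GA Ax).
have trivD : trivIset (GG :\: P) := trivIsetS (subsetDl _ _) trivG.
move: trivD => /eqP <-.
rewrite (eq_bigr (fun=> v)) => [|A /setDP[/cardG]//].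
by rewrite sum_nat_const cardsD (setIidPr sPG) card_in_imset.
Qed.

(** * Lowering the strength of a design *)

(* Double count the pairs [(x, B)] with [x] outside [S] and [S :|: [set x]]
   inside the block [B]. *)
Lemma gdd_balanced_pred (R : finType) (lambda s k r v g : nat)
    (BB GG : {set {set R}}) (S : {set R}) :
  is_GDD lambda s.+1 k r v g BB GG ->
  #|S| = s -> at_most_one_per_group GG S ->
  (#|[set B in BB | S \subset B]| * (k - s) = lambda * ((g - s) * v))%N.
Proof.
move=> gdd cardS oneS; have partG := gdd_partition gdd.
have /and3P[/eqP covG trivG _] := partG.
have inG x : x \in cover GG by rewrite covG inE.
have -> : (#|[set B in BB | S \subset B]| * (k - s) =
    \sum_(x in ~: S) #|[set B in BB | x |: S \subset B]|)%N.
  under [RHS]eq_bigr => x _ do rewrite -sum1dep_card.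
  rewrite (exchange_big_dep [in [set B in BB | S \subset B]]) /=; last first.
    move=> x B _; rewrite inE subUset => /and3P[-> _ //].
  rewrite -sum_nat_const; apply: eq_bigr => B; rewrite inE => /andP[BBB sSB].
  rewrite sum1dep_card -(gdd_card_block gdd BBB) -cardS -{1}(setIidPr sSB).
  rewrite -cardsD.
  apply: eq_card => x; rewrite !inE BBB subUset sSB sub1set andbT.
  by case: (x \in S).
(* A point of [E] extends [S] to a set lying in [lambda] blocks. Any other point outside [S] shares
   a group with a point of [S], so no block contains it together with [S]. *)
set E := [set x | pblock GG x \notin pblock GG @: S].
have sE : E \subset ~: S.
  by apply/subsetP => x; rewrite !inE; apply: contra => /(imset_f (pblock GG)).
rewrite (big_setID E) /= (setIidPr sE) [X in (_ + X)%N]big1 ?addn0; last first.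
  move=> x; rewrite !inE negbK => /andP[/imsetP[y Sy eqxy] xS].
  apply: eq_card0 => B; rewrite !inE subUset sub1set.
  apply/negP => /and3P[BBB Bx /subsetP sSB].
  have /(at_most_one_per_groupP _ partG) injB := gdd_block_group gdd BBB.
  by move: xS; rewrite (injB x y Bx (sSB _ Sy) eqxy) Sy.
rewrite (eq_bigr (fun=> lambda)) => [|x Ex].
  rewrite sum_nat_const mulnC; congr muln.
  by rewrite (card_groups_missed partG (gdd_card_group gdd)) //
    (gdd_card_groups gdd) cardS.
apply: (gdd_balanced gdd).
  by rewrite cardsU1 cardS; move/subsetP/(_ x Ex): sE; rewrite inE => ->.
apply/(at_most_one_per_groupP _ partG) => y z.
move: Ex oneS; rewrite inE => nx /(at_most_one_per_groupP _ partG) injS.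
case/setU1P=> [-> | Sy] /setU1P[-> // | Sz] eqyz.
- by rewrite eqyz imset_f in nx.
- by rewrite -eqyz imset_f in nx.
- exact: injS.
Qed.

(** The index at strength [s] of a design with index [lambda] at strength [s.+1]; [gdd_pred] shows
    that the division is then exact. *)
Definition pred_index (lambda s k v g : nat) : nat :=
  (lambda * ((g - s) * v) %/ (k - s))%N.

Lemma gdd_pred (R : finType) (lambda s k r v g : nat) (BB GG : {set {set R}}) :
  (0 < s)%N -> is_GDD lambda s.+1 k r v g BB GG ->
  is_GDD (pred_index lambda s k v g) s k r v g BB GG /\
  (pred_index lambda s k v g * (k - s) = lambda * ((g - s) * v))%N.
Proof.
move=> s_gt0 gdd; have lt_sk := gdd_le_tk gdd.
have ks_gt0 : (0 < k - s)%N by rewrite subn_gt0.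
have le_sg : (s < g)%N := leq_trans lt_sk (gdd_le_kg gdd).
have eqI (S : {set R}) : #|S| = s -> at_most_one_per_group GG S ->
    #|[set B in BB | S \subset B]| = pred_index lambda s k v g.
  move=> cardS oneS.
  by rewrite /pred_index -(gdd_balanced_pred gdd cardS oneS) mulnK.
(* The block count of one actual partial transversal of size [s] witnesses that the division leaves
   no remainder. *)
have [|S cardS oneS] := exists_transversal_of_card (s := s) (gdd_partition gdd).
  by rewrite (gdd_card_groups gdd) ltnW.
have eqS : (pred_index lambda s k v g * (k - s) = lambda * ((g - s) * v))%N.
  by rewrite -(eqI _ cardS oneS) (gdd_balanced_pred gdd).
split=> //; have [l0 _ v0 _ lekg legr rE cP cB cG cg pG bG _] := gdd.
split=> //; last exact: ltnW.
have : (0 < pred_index lambda s k v g * (k - s))%N.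
  by rewrite eqS !muln_gt0 l0 v0 subn_gt0 le_sg.
by rewrite muln_gt0 => /andP[].
Qed.

(** The index [mu] is chosen before the blocks, so two designs with the same parameters and groups
    share it. *)
Lemma gdd_lower (R : finType) (lambda s t k r v g : nat)
    (GG : {set {set R}}) :
  (0 < s <= t)%N -> exists mu, forall BB,
  is_GDD lambda t k r v g BB GG -> is_GDD mu s k r v g BB GG.
Proof.
move=> /andP[s_gt0 /subnKC <-]; elim: (t - s)%N lambda => [|d IHd] lambda.
  by exists lambda; rewrite addn0.
have [mu muP] := IHd (pred_index lambda (s + d) k v g).
exists mu => BB; rewrite addnS => /gdd_pred[|gdd _]; last exact: muP.
by rewrite addn_gt0 s_gt0.
Qed.

(** * Moments of the characteristic vectors *)

Lemma char_vec_monomial (r : nat) (e : 'I_r -> nat) (B : {set 'I_r}) :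
  \prod_(j < r) char_vec B ord0 j ^+ e j =
    (([set j | 0 < e j]%N \subset B)%:R : rat).
Proof.
case: subsetP => [sub | nsub].
  rewrite big1 // => j _; rewrite mxE.
  case: ifPn => [_|nB]; first by rewrite expr1n.
  (* Off the block the entry is 0, but so is the exponent, and [0 ^+ 0 = 1]. *)
  have /implyP := sub j; rewrite inE (negPf nB) implybF lt0n negbK => /eqP ->.
  by rewrite expr0.
have [j] : exists j, (j \in [set j | 0 < e j]%N) && (j \notin B).
  apply/existsP; apply: contra_notT nsub; rewrite negb_exists => /forallP h j ej.
  by have := h j; rewrite ej negbK.
rewrite inE => /andP[ej nB].
by rewrite (bigD1 j) //= mxE (negPf nB) expr0n eqn0Ngt ej mul0r.
Qed.

Lemma char_vecs_moment (r : nat) (e : 'I_r -> nat) (BB : {set {set 'I_r}}) :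
  \sum_(a <- char_vecs BB) \prod_(j < r) a ord0 j ^+ e j =
    (#|[set B in BB | [set j | 0 < e j]%N \subset B]|%:R : rat).
Proof.
rewrite big_map big_enum /= -sum1dep_card natr_sum [RHS]big_mkcondr /=.
by apply: eq_bigr => B _; rewrite char_vec_monomial; case: (_ \subset _).
Qed.

(** If [T] meets some group twice, no block of either design contains it; otherwise both counts are
    the common index at strength [#|T|]. *)
Lemma gdd_count_eq (R : finType) (lambda t k r v g : nat)
    (BB1 BB2 GG : {set {set R}}) (T : {set R}) :
  is_GDD lambda t k r v g BB1 GG -> is_GDD lambda t k r v g BB2 GG ->
  (0 < #|T| <= t)%N ->
  #|[set B in BB1 | T \subset B]| = #|[set B in BB2 | T \subset B]|.
Proof.
move=> gdd1 gdd2 cardT.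
have [mu muP] := @gdd_lower R lambda _ t k r v g GG cardT.
have [oneT | notT] := boolP [forall Gi in GG, #|T :&: Gi| <= 1]%N.
  have one : at_most_one_per_group GG T by move=> Gi; exact/(forall_inP oneT).
  by rewrite (gdd_balanced (muP _ gdd1)) // (gdd_balanced (muP _ gdd2)).
have none BB : is_GDD lambda t k r v g BB GG ->
    [set B in BB | T \subset B] = set0.
  move=> gdd; apply/setP => B; rewrite !inE.
  apply: contraNF notT => /andP[/(gdd_block_group gdd) oneB sTB].
  by apply/forall_inP; exact: at_most_one_per_groupS sTB oneB.
by rewrite (none _ gdd1) (none _ gdd2).
Qed.

Lemma gdd_is_PTE (lambda t k g v r b : nat) (BB1 BB2 GG : {set {set 'I_r}}) :
  is_GDD lambda t k r v g BB1 GG -> is_GDD lambda t k r v g BB2 GG ->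
  disjoint_designs BB1 BB2 -> #|BB1| = b -> #|BB2| = b ->
  is_PTE t b (char_vecs BB1) (char_vecs BB2).
Proof.
move=> gdd1 gdd2 disj card1 card2; split.
- by rewrite size_map -cardE.
- by rewrite size_map -cardE.
- move=> _ [/mapP[B + ->] /mapP[C + /char_vec_inj eqBC]].
  rewrite -eqBC !mem_enum => B1 B2.
  by move/setP/(_ B): disj; rewrite !inE B1 B2.
move=> e /andP[e_gt0 e_le]; rewrite !char_vecs_moment.
congr (_%:R); apply: (gdd_count_eq gdd1 gdd2).
(* The support is nonempty because the degree is positive, and has at most [t] points because each
   contributes at least 1 to the degree. *)
have supp_sum : (\sum_(j < r) e j = \sum_(j in [set j | 0 < e j]) e j)%N.
  rewrite [RHS]big_mkcond; apply: eq_bigr => j _.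
  by rewrite inE lt0n; case: eqP.
apply/andP; split.
  apply: contraTT e_gt0; rewrite -leqNgt leqn0 cards_eq0 => /eqP e0.
  by rewrite supp_sum e0 big_set0.
apply: leq_trans e_le; rewrite supp_sum -sum1_card.
by apply: leq_sum => j; rewrite inE.
Qed.

(** * Rank of the block-point matrix *)

(* Summing the block equations over the blocks through [i] gives
   [l1 x_i + l2 (S - S_G) = 0], where [S] is the sum of all [x_j] and [S_G] the
   sum over the group [G] of [i]; then sum over [G], and over all groups. *)
Lemma gdd_block_sums_inj (F : numFieldType) (R : finType)
    (l1 l2 k r v g : nat) (BB GG : {set {set R}}) (x : R -> F) :
  is_GDD l1 1 k r v g BB GG -> is_GDD l2 2 k r v g BB GG ->
  (l2 * v < l1)%N -> (forall B, B \in BB -> \sum_(j in B) x j = 0) ->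
  forall i, x i = 0.
Proof.
move=> gdd1 gdd2 lt_l sumB; have partG := gdd_partition gdd1.
have /and3P[/eqP covG trivG _] := partG.
have inG y : y \in cover GG by rewrite covG inE.
pose S := \sum_j x j; pose SG (G : {set R}) := \sum_(j in G) x j.
have l1N0 : l1%:R != 0 :> F by rewrite pnatr_eq0 -lt0n (gdd_lambda_gt0 gdd1).
have point i : l1%:R * x i + l2%:R * (S - SG (pblock GG i)) = 0.
  have : \sum_(B in BB | i \in B) \sum_(j in B) x j = 0.
    by rewrite big1 // => B /andP[/sumB].
  (* After the exchange, [x j] is weighted by the number of blocks through [i] and [j]: [l1] if
     [j = i], 0 for other [j] in the group of [i], [l2] elsewhere. *)
  rewrite (exchange_big_dep predT) //= => eq0; rewrite -{}[RHS]eq0.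
  under [RHS]eq_bigr => j _ do rewrite sumr_const.
  have iG : i \in pblock GG i by rewrite mem_pblock inG.
  have -> : S = SG (pblock GG i) + \sum_(j in ~: pblock GG i) x j.
    rewrite /S (bigID [in pblock GG i]) /=; congr (_ + _).
    by apply: eq_bigl => j; rewrite inE.
  rewrite [_ + _ - _]addrC addKr [RHS](bigID [in pblock GG i]) /=.
  congr (_ + _).
    rewrite (bigD1 i) //= [X in _ + X]big1 ?addr0 => [|j /andP[jG ji]].
      rewrite mulr_natl; congr (_ *+ _).
      have /(gdd_balanced gdd1) <- : at_most_one_per_group GG [set i].
          by move=> Gi _; rewrite -(cards1 i) subset_leq_card ?subsetIl.
        by apply: eq_card => B; rewrite !inE sub1set [RHS]unfold_in -andbA andbb.
      by rewrite cards1.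
    rewrite (_ : #|_| = 0%N) ?mulr0n //; apply: eq_card0 => B.
    rewrite unfold_in /=; apply/negP => /andP[/andP[BBB Bi] Bj].
    have /card_le1_eqP one := gdd_block_group gdd1 BBB (pblock_mem (inG i)).
    by move/eqP: ji; apply; apply: one; rewrite inE ?Bi ?Bj.
  rewrite mulr_sumr; apply: eq_big => j; first by rewrite inE.
  rewrite inE => njG; rewrite mulr_natl; congr (_ *+ _).
  have ij : i != j by apply: contraNneq njG => <-.
  rewrite -(gdd_balanced gdd2 (T := [set i; j])) ?cards2 ?ij //.
    by apply: eq_card => B; rewrite !inE subUset !sub1set [RHS]unfold_in andbA.
  apply/(at_most_one_per_groupP _ partG) => y z.
  have neqG : pblock GG i <> pblock GG j.
    by move/eqP; rewrite eq_pblock // (negPf njG).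
  by case/set2P=> -> /set2P[] -> // /esym // /neqG.
have group G : G \in GG -> l1%:R * SG G + (l2 * v)%:R * (S - SG G) = 0.
  move=> GGG.
  rewrite -[RHS](big1 _ _ _ (fun i _ => point i) : \sum_(i in G) _ = 0).
  rewrite big_split /= -mulr_sumr; congr (_ + _).
  rewrite (eq_bigr (fun=> l2%:R * (S - SG G))) => [|i iG].
    rewrite sumr_const (gdd_card_group gdd1) // -[RHS]mulr_natl.
    by rewrite natrM mulrA [v%:R * _]mulrC.
  by rewrite (def_pblock trivG GGG iG).
have S0 : S = 0.
  have sumS : \sum_(G in GG) SG G = S.
    rewrite -(set_partition_big _ partG) /=.
    by apply: eq_bigl => j; rewrite inE.
  have : \sum_(G in GG) (l1%:R * SG G + (l2 * v)%:R * (S - SG G)) = 0.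
    exact: big1.
  rewrite big_split /= -!mulr_sumr sumrB sumS sumr_const (gdd_card_groups gdd1).
  have g_gt0 : (0 < g)%N := leq_trans (gdd_le_tk gdd1) (gdd_le_kg gdd1).
  (* The total is [(l1 + l2 * v * g.-1) * S], whose first factor is positive. *)
  rewrite -[in S *+ g](prednK g_gt0) mulrS addrAC subrr add0r -[S *+ _]mulr_natl.
  rewrite mulrA -natrM -mulrDl -natrD => /eqP.
  rewrite mulf_eq0 pnatr_eq0 addn_eq0 eqn0Ngt (gdd_lambda_gt0 gdd1) /=.
  by move/eqP.
(* With [S = 0] the group equation reads [(l1 - l2 * v) * SG G = 0], and the strict inequality makes
   the first factor nonzero. *)
have SG0 G : G \in GG -> SG G = 0.
  move/group; rewrite S0 sub0r mulrN -mulrBl => /eqP.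
  rewrite mulf_eq0 subr_eq0 eqr_nat gtn_eqF //= => /eqP //.
move=> i; have := point i.
rewrite S0 SG0 ?pblock_mem // subr0 mulr0 addr0 => /eqP.
by rewrite mulf_eq0 (negPf l1N0) => /eqP.
Qed.

(** Full column rank means that a weighting of the points with sum 0 on every block vanishes;
    strength 2 supplies both indices needed for this. *)
Lemma gdd_char_rank (lambda t k g v r b : nat) (BB GG : {set {set 'I_r}}) :
  is_GDD lambda t k r v g BB GG -> #|BB| = b -> (k < g)%N -> (2 <= t)%N ->
  \rank (rows_mx b (char_vecs BB)) = r.
Proof.
move=> gdd cardB lt_kg t_ge2.
have [l2 /(_ BB gdd) gdd2] : exists mu, forall BB,
    is_GDD lambda t k r v g BB GG -> is_GDD mu 2 k r v g BB GG.
  exact: gdd_lower.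
have [] := gdd_pred (ltn0Sn 0) gdd2; set l1 := pred_index _ _ _ _ _ => gdd1 eq_l.
have lt_l : (l2 * v < l1)%N.
  have k_gt1 := gdd_le_tk gdd2; have := gdd_lambda_gt0 gdd2.
  have := gdd_v_gt0 gdd2; move: eq_l; rewrite -[(_ * v)%N]mulnC mulnA.
  move=> eq_l v0 l0; have lv0 : (0 < l2 * v)%N by rewrite muln_gt0 l0.
  have k1_gt0 : (0 < k - 1)%N by rewrite subn_gt0.
  by rewrite -(ltn_pmul2r k1_gt0) eq_l ltn_pmul2l // ltn_sub2r //
    (leq_trans k_gt1 (ltnW lt_kg)).
rewrite -mxrank_tr; apply/eqP; apply: inj_row_free => x x0.
apply/rowP => i; rewrite mxE.
apply: (gdd_block_sums_inj (x := fun j => x ord0 j) gdd1 gdd2 lt_l) => B BBB.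
have lt_idx : (index B (enum BB) < b)%N.
  by rewrite -cardB cardE index_mem mem_enum.
move/rowP/(_ (Ordinal lt_idx)): x0; rewrite !mxE => eq0; rewrite -[RHS]eq0.
rewrite big_mkcond; apply: eq_bigr => j _; rewrite !mxE /=.
rewrite (nth_map B) ?nth_index ?mem_enum ?index_mem ?mem_enum // mxE.
by case: ifP; rewrite ?mulr1 ?mulr0.
Qed.

Theorem theorem4p5 (lambda t k g v r b : nat)
    (BB1 BB2 GG : {set {set 'I_r}})
    (gdd1 : is_GDD lambda t k r v g BB1 GG)
    (gdd2 : is_GDD lambda t k r v g BB2 GG)
    (disj : disjoint_designs BB1 BB2)
    (card1 : #|BB1| = b) (card2 : #|BB2| = b)
    (lt_kg : (k < g)%N) :
  is_PTE t b (char_vecs BB1) (char_vecs BB2) /\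
  ((2 <= t)%N -> is_proper_PTE t b (char_vecs BB1) (char_vecs BB2)).
Proof.
have pte := gdd_is_PTE gdd1 gdd2 disj card1 card2.
split=> // t_ge2; split=> //.
  exact: gdd_char_rank gdd1 card1 lt_kg t_ge2.
exact: gdd_char_rank gdd2 card2 lt_kg t_ge2.
Qed.
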